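(* Consider an instance of the nested $p$-center problem with the minimizing the maximum relative regret objective. The following mixed-integer linear program (nPCR2) is a valid formulation for this problem: minimize $w$ subject to - $\sum_{j\in\mathcal J}y_j^h=p^h$ for all $h\in\mathcal H$; - $w\ge\frac{1}{d^{h*}}\Bigl(d_{ij}-\sum_{j'\in\mathcal J:\,d_{ij'}<d_{ij}}(d_{ij}-d_{ij'})\,y_{j'}^h\Bigr)-1$ for all $i\in\mathcal I$, $j\in\mathcal J$, $h\in\mathcal H$; - $y_j^h\ge y_j^{h-1}$ for all $j\in\mathcal J$, $h\in\mathcal H\setminus\{1\}$; - $y_j^h\in\{0,1\}$ for all $j\in\mathcal J$, $h\in\mathcal H$, and $w\in\mathbb R_{\ge0}$.
   Context: Instance: $\mathcal I$ is a finite nonempty set of customer demand points, $\mathcal J$ a finite nonempty set of potential facility locations, with distances $d_{ij}\ge 0$. The time horizon is $\mathcal H=\{1,\dots,H\}$, and $p^1,\dots,p^H$ are positive integers with $p^h\le p^{h+1}$ for $h=1,\dots,H-1$ and $p^H\le|\mathcal J|$. For nonempty $S\subseteq\mathcal J$ let $d(S)=\max_{i\in\mathcal I}\min_{j\in S}d_{ij}$. Let $d^{h*}=\min\{d(S):S\subseteq\mathcal J,\ |S|=p^h\}$ be the optimal value of the $p$-center problem for $p=p^h$, assumed positive for all $h\in\mathcal H$. A feasible solution $(\mathcal J^1,\dots,\mathcal J^H)$ consists of sets $\mathcal J^h\subseteq\mathcal J$ with $|\mathcal J^h|=p^h$ for $h\in\mathcal H$ and $\mathcal J^h\subseteq\mathcal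 J^{h+1}$ for $h=1,\dots,H-1$. The nested $p$-center problem with the minimizing the maximum relative regret objective asks for a feasible solution minimizing $\max_{h\in\mathcal H}\frac{d(\mathcal J^h)-d^{h*}}{d^{h*}}$. ''Valid formulation'' means: via $\mathcal J^h=\{j\in\mathcal J: y_j^h=1\}$, the $y$-parts of feasible points of the program correspond one-to-one to feasible solutions of the problem, and for each such $y$ the minimum feasible $w$ equals the objective value $\max_{h\in\mathcal H}\frac{d(\mathcal J^h)-d^{h*}}{d^{h*}}$ of the corresponding solution. *)

(* Defs.v *)
From mathcomp Require Import all_boot all_order all_algebra.
Set Implicit Arguments.
Unset Strict Implicit.
Unset Printing Implicit Defensive.
Import Order.TTheory GRing.Theory Num.Theory.
Local Open Scope ring_scope.

(* Maximum and minimum of F over A; the value 0 on an empty A is junk. *)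
Definition max_over (R : realFieldType) (T : finType) (A : {pred T})
    (F : T -> R) : R :=
  if [pick x in A] is Some x0 then F [arg max_(x > x0 in A) F x]%O else 0.

Definition min_over (R : realFieldType) (T : finType) (A : {pred T})
    (F : T -> R) : R :=
  if [pick x in A] is Some x0 then F [arg min_(x < x0 in A) F x]%O else 0.

Lemma max_overP (R : realFieldType) (T : finType) (A : {pred T}) (F : T -> R)
    (x0 : T) : x0 \in A ->
  (exists2 x, x \in A & max_over A F = F x) /\
  (forall x, x \in A -> F x <= max_over A F).
Proof.
move=> Ax0; rewrite /max_over; case: pickP => [x1 Ax1|/(_ x0)]; last first.
  by rewrite Ax0.
by case: arg_maxP => // x Ax xmax; split=> [|z /xmax//]; exists x.
Qed.

Lemma min_overP (R : realFieldType) (T : finType) (A : {pred T}) (F : T -> R)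
    (x0 : T) : x0 \in A ->
  (exists2 x, x \in A & min_over A F = F x) /\
  (forall x, x \in A -> min_over A F <= F x).
Proof.
move=> Ax0; rewrite /min_over; case: pickP => [x1 Ax1|/(_ x0)]; last first.
  by rewrite Ax0.
by case: arg_minP => // x Ax xmin; split=> [|z /xmin//]; exists x.
Qed.

(* d(S), meaningful for nonempty S *)
Definition radius (R : realFieldType) (I J : finType) (d : I -> J -> R)
    (S : {set J}) : R :=
  max_over [set: I] (fun i => min_over S (fun j => d i j)).

Definition pcenter_opt (R : realFieldType) (I J : finType) (d : I -> J -> R)
    (k : nat) : R :=
  min_over [set S : {set J} | #|S| == k] (radius d).

(* The time periods 1, ..., H are represented by 0, ..., H - 1 in 'I_H;
   g and h are consecutive periods when h = g.+1 as natural numbers. *)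
Definition nested_feasible (J : finType) (H : nat) (p : 'I_H -> nat)
    (X : {ffun 'I_H -> {set J}}) : Prop :=
  (forall h, #|X h| = p h) /\
  (forall g h : 'I_H, h = g.+1 :> nat -> X g \subset X h).

Definition max_rel_regret (R : realFieldType) (I J : finType) (d : I -> J -> R)
    (H : nat) (p : 'I_H -> nat) (X : {ffun 'I_H -> {set J}}) : R :=
  max_over [set: 'I_H] (fun h =>
    (radius d (X h) - pcenter_opt d (p h)) / pcenter_opt d (p h)).

Definition open_sets (R : realFieldType) (J : finType) (H : nat)
    (y : {ffun J * 'I_H -> R}) : {ffun 'I_H -> {set J}} :=
  [ffun h => [set j | y (j, h) == 1]].

(* P y w says that (y, w) is a feasible point of a program that minimizes w. *)
Definition valid_formulation (R : realFieldType) (I J : finType)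
    (d : I -> J -> R) (H : nat) (p : 'I_H -> nat)
    (P : {ffun J * 'I_H -> R} -> R -> Prop) : Prop :=
  [/\ (forall y, (exists w, P y w) -> nested_feasible p (open_sets y)),
      (forall X, nested_feasible p X ->
         exists! y, (exists w, P y w) /\ open_sets y = X)
    & (forall y, (exists w, P y w) ->
         P y (max_rel_regret d p (open_sets y)) /\
         (forall w, P y w -> max_rel_regret d p (open_sets y) <= w))].

Definition nPCR2 (R : realFieldType) (I J : finType) (d : I -> J -> R)
    (H : nat) (p : 'I_H -> nat) (y : {ffun J * 'I_H -> R}) (w : R) : Prop :=
  (forall h, \sum_(j : J) y (j, h) = (p h)%:R) /\
  (forall i j h,
     w >= 1 / pcenter_opt d (p h) *
          (d i j - \sum_(j' : J | d i j' < d i j) (d i j - d i j') * y (j', h))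
          - 1) /\
  (forall j (g h : 'I_H), h = g.+1 :> nat -> y (j, h) >= y (j, g)) /\
  (forall j h, y (j, h) = 0 \/ y (j, h) = 1) /\
  0 <= w.

(* Main.v *)
Require Import Defs.
From mathcomp Require Import all_boot all_order all_algebra.
Set Implicit Arguments.
Unset Strict Implicit.
Unset Printing Implicit Defensive.
Import Order.TTheory GRing.Theory Num.Theory.
Local Open Scope ring_scope.

(** A binary vector [y] carries the same data as the family of sets it
    indicates, so every feasible point of the program is [(incidence X, w)] for
    a unique family [X], and the cardinality and monotonicity constraints say
    that [X] is a feasible solution of the nested problem.  What remains is to
    see that, once [X] is fixed, the constraints on [w] amount to
    [w >= max_rel_regret d p X].

    Fix a period and let [S] be its set of open facilities.  For a customer [i]
    whose nearest facility in [S] is [s], put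
    [cut i j = d i j - \sum_(j' in S | d i j' < d i j) (d i j - d i j')].
    If [s] is strictly closer to [i] than [j], then the sum contains the term
    [d i j - d i s] and its other terms are nonnegative, so [cut i j <= d i s];
    otherwise [cut i j <= d i j <= d i s].  For [j = s] the sum is empty and
    [cut i s = d i s].  Hence a number bounds all the cuts of [i] exactly when
    it bounds [d i s] ([cut_le_min]), and bounds the cuts of all customers
    exactly when it bounds the radius of [S] ([cut_le_radius]).  Dividing by the
    positive optimal value and subtracting 1 turns the radius into the relative
    regret of the period.

    Finally, [X h] is itself a candidate in the [p h]-center problem, so every
    regret is nonnegative; so [w = max_rel_regret d p X] also satisfies [0 <= w]
    and is the least feasible value ([nPCR2_incidence]). *)

(** * Extrema over nonempty sets *)

Lemma max_over_leP (R : realFieldType) (T : finType) (A : {pred T})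
    (F : T -> R) (x0 : T) (w : R) : x0 \in A ->
  max_over A F <= w <-> (forall x, x \in A -> F x <= w).
Proof.
move=> Ax0; have [[x Ax maxE] F_le] := max_overP F Ax0.
by split=> [max_w z /F_le/le_trans->//|F_w]; rewrite maxE F_w.
Qed.

Lemma pcenter_opt_le_radius (R : realFieldType) (I J : finType)
    (d : I -> J -> R) (S : {set J}) : pcenter_opt d #|S| <= radius d S.
Proof.
have AS : S \in [set S' : {set J} | #|S'| == #|S|] by rewrite inE.
exact: (min_overP (radius d) AS).2.
Qed.

(** * The cuts of one period *)

Definition cut (R : realFieldType) (I J : finType) (d : I -> J -> R)
    (S : {set J}) (i : I) (j : J) : R :=
  d i j - \sum_(j' in S | d i j' < d i j) (d i j - d i j').

(** Truncating at [d i j] replaces the distance from [i] to its nearest open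
    facility by a lower bound, which is attained when [j] is that facility. *)
Lemma cut_le_min (R : realFieldType) (I J : finType) (d : I -> J -> R)
    (S : {set J}) (i : I) (c : R) : (0 < #|S|)%N ->
  (forall j, cut d S i j <= c) <-> min_over S (d i) <= c.
Proof.
case/card_gt0P=> s0 Ss0; have [[s Ss minE]] := min_overP (d i) Ss0.
rewrite minE => smin.
split=> [/(_ s)|dsc j].
  rewrite /cut big_pred0 ?subr0 // => j.
  by apply/negP=> /andP[/smin]; rewrite leNgt => /negP.
apply: le_trans dsc; rewrite /cut lerBlDl.
have terms_ge0 (P : pred J) :
    0 <= \sum_(j' in S | (d i j' < d i j) && P j') (d i j - d i j').
  by apply: sumr_ge0 => j' /and3P[_ /ltW]; rewrite subr_ge0.
have [dsj|djs] := ltP (d i s) (d i j).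
  rewrite (bigD1 s) ?Ss //= addrAC subrK lerDl.
  by under eq_bigl do rewrite -andbA; exact: terms_ge0.
apply: ler_wpDl => //; have := terms_ge0 predT.
by under eq_bigl do rewrite andbT.
Qed.

Lemma cut_le_radius (R : realFieldType) (I J : finType) (d : I -> J -> R)
    (S : {set J}) (c : R) : (0 < #|I|)%N -> (0 < #|S|)%N ->
  (forall i j, cut d S i j <= c) <-> radius d S <= c.
Proof.
case/card_gt0P=> i0 _ S_gt0.
have max_le := max_over_leP (fun i => min_over S (d i)) c (in_setT i0).
split=> [cut_c|/max_le min_c i].
  by apply/max_le=> i _; apply/(cut_le_min d i c S_gt0).
by apply/(cut_le_min d i c S_gt0); apply: min_c; rewrite inE.
Qed.

(** * Incidence vectors *)

Definition incidence (R : realFieldType) (J : finType) (H : nat)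
    (X : {ffun 'I_H -> {set J}}) : {ffun J * 'I_H -> R} :=
  [ffun jh => (jh.1 \in X jh.2)%:R].

Lemma incidenceK (R : realFieldType) (J : finType) (H : nat) :
  cancel (@incidence R J H) (@open_sets R J H).
Proof.
move=> X; apply/ffunP=> h; apply/setP=> j.
by rewrite !ffunE inE ffunE /= pnatr_eq1 eqb1.
Qed.

Lemma open_setsK (R : realFieldType) (J : finType) (H : nat)
    (y : {ffun J * 'I_H -> R}) :
  (forall j h, y (j, h) = 0 \/ y (j, h) = 1) -> incidence R (open_sets y) = y.
Proof.
move=> y01; apply/ffunP=> -[j h]; rewrite !ffunE inE /=.
by case: (y01 j h) => ->; rewrite ?eqxx // eq_sym oner_eq0.
Qed.

(** * Feasible points of the program *)

(** Each constraint is translated separately: the sums into cardinalities, the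
    order of the entries into inclusions, the cuts into a bound on the radius,
    and the sign of [w] follows from the bound on the regret of any period. *)
Lemma nPCR2_incidence (R : realFieldType) (I J : finType) (d : I -> J -> R)
    (H : nat) (p : 'I_H -> nat) (X : {ffun 'I_H -> {set J}}) (w : R) :
  (0 < #|I|)%N -> (0 < H)%N -> (forall h, (0 < p h)%N) ->
  (forall h, 0 < pcenter_opt d (p h)) ->
  nPCR2 d p (incidence R X) w <->
  nested_feasible p X /\ max_rel_regret d p X <= w.
Proof.
move=> I_gt0 H_gt0 p_gt0 opt_gt0; pose h0 := Ordinal H_gt0.
have sum_card h : \sum_(j : J) incidence R X (j, h) = #|X h|%:R.
  under eq_bigr do rewrite ffunE /=.
  by rewrite -natr_sum -sum1_card [in RHS]big_mkcond.
have sum_cut i j h : d i j - \sum_(j' : J | d i j' < d i j)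
    (d i j - d i j') * incidence R X (j', h) = cut d (X h) i j.
  rewrite /cut [X in _ = _ - X]big_mkcondl /=; congr (_ - _).
  by apply: eq_bigr => j' _; rewrite ffunE /=; case: ifP; rewrite ?mulr1 ?mulr0.
have mono g h : (X g \subset X h) <->
    (forall j, incidence R X (j, h) >= incidence R X (j, g)).
  split=> [/subsetP Xgh j|le_gh]; last apply/subsetP=> j.
    by rewrite !ffunE ler_nat /=; case: (boolP (j \in X g)) => // /Xgh->.
  have:= le_gh j; rewrite !ffunE ler_nat /=.
  by case: (j \in X h); case: (_ \in _).
have regretP := max_over_leP (fun h =>
  (radius d (X h) - pcenter_opt d (p h)) / pcenter_opt d (p h)) w (in_setT h0).
(* Clearing the denominator turns both the cut constraint and the regret bound
   into bounds by (w + 1) * pcenter_opt d (p h). *)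
have cutE i j h : (w >= 1 / pcenter_opt d (p h) * cut d (X h) i j - 1) =
    (cut d (X h) i j <= (w + 1) * pcenter_opt d (p h)).
  by rewrite lerBlDr mul1r mulrC ler_pdivrMr.
have regretE h :
    ((radius d (X h) - pcenter_opt d (p h)) / pcenter_opt d (p h) <= w) =
    (radius d (X h) <= (w + 1) * pcenter_opt d (p h)).
  by rewrite ler_pdivrMr // lerBlDr mulrDl mul1r.
split=> [[sum_p [w_cut [y_mono _]]]|[[card_X X_mono] /regretP regret_w]].
  have card_X h : #|X h| = p h.
    by apply/eqP; rewrite -(eqr_nat R) -sum_card sum_p.
  split; first by split=> // g h gh; apply/mono => j; exact: y_mono.
  apply/regretP=> h _; rewrite regretE; apply/cut_le_radius; rewrite ?card_X //.
  by move=> i j; rewrite -cutE -sum_cut.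
split=> [h|]; first by rewrite sum_card card_X.
split=> [i j h|].
  rewrite sum_cut cutE; apply: (cut_le_radius d _ I_gt0 _).2.
    by rewrite card_X.
  by rewrite -regretE regret_w ?inE.
split=> [j g h gh|]; first exact: (mono g h).1 (X_mono g h gh) j.
split=> [j h|]; first by rewrite ffunE /=; case: (_ \in _); [right | left].
apply: le_trans (regret_w h0 _); rewrite ?inE // divr_ge0 ?(ltW (opt_gt0 _)) //.
by rewrite subr_ge0 -card_X pcenter_opt_le_radius.
Qed.

Theorem proposition17 (R : realFieldType) (I J : finType)
    (hI : (0 < #|I|)%N) (hJ : (0 < #|J|)%N)
    (d : I -> J -> R) (hd : forall i j, 0 <= d i j)
    (H : nat) (hH : (0 < H)%N) (p : 'I_H -> nat)
    (hp_pos : forall h, (0 < p h)%N)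
    (hp_mono : forall g h : 'I_H, h = g.+1 :> nat -> (p g <= p h)%N)
    (hp_last : forall h : 'I_H, h.+1 = H -> (p h <= #|J|)%N)
    (hopt : forall h, 0 < pcenter_opt d (p h)) :
  valid_formulation d p (nPCR2 d p).
Proof.
have binE y w : nPCR2 d p y w -> incidence R (open_sets y) = y.
  by case=> _ [_ [_ [y01 _]]]; exact: open_setsK.
have feasP X w := nPCR2_incidence X w hI hH hp_pos hopt.
split=> [y [w Pyw]|X feasX|y [w0 Pyw0]].
- by move: (Pyw); rewrite -{1}(binE _ _ Pyw) => /feasP[].
- exists (incidence R X); split=> [|y [[w Pyw] <-]]; last exact: binE Pyw.
  rewrite incidenceK; split=> //; exists (max_rel_regret d p X).
  exact/feasP.
- have feas_y w : nPCR2 d p y w <-> nested_feasible p (open_sets y) /\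
      max_rel_regret d p (open_sets y) <= w.
    by rewrite -{1}(binE _ _ Pyw0); exact: feasP.
  have [feas _] := (feas_y w0).1 Pyw0.
  by split=> [|w]; [exact/feas_y | case/feas_y].
Qed.
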